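(* Let $(S,\mathcal{F},F^*,\{c^j\}_{j\in[k]},-\infty,+\infty,\|\cdot\|_{\infty,w})$ be a feasible (unconstrained) minimum-cost inverse optimization problem with multiple cost functions. Then $$\min\big\{\|p\|_{\infty,w}\ \big|\ p \text{ is a feasible deviation vector}\big\}=\max\left\{0,\ \max\left\{\frac{c^j(F^* )-c^j(F)}{\frac{1}{w}(F^*\triangle F)}\ \middle|\ j\in[k],\ F\in\mathcal{F},\ F\ne F^*\right\}\right\}.$$
   Context: Here $S$ is a nonempty finite ground set, $\mathcal{F}\subseteq 2^S$ is a collection of feasible solutions of an underlying optimization problem, $F^*\in\mathcal{F}$ is an input solution, $k$ is a positive integer, $[k]=\{1,\dots,k\}$, $c^1,\dots,c^k\in\mathbb{R}^S$ are cost functions, and $w\in\mathbb{R}_+^S$ is a positive weight function (all $w(s)>0$). For $x\in\mathbb{R}^S$ and $X\subseteq S$, $x(X)=\sum_{s\in X}x(s)$ and $\frac{1}{w}(X)=\sum_{s\in X}\frac{1}{w(s)}$. The symmetric difference is $X\triangle Y=(X\setminus Y)\cup(Y\setminus X)$. Convention: $\max\emptyset=-\infty$. The symbols $-\infty,+\infty$ in the problem mean that there are no lower or upper bounds on the coordinates of deviation vectors. A deviation vector $p\in\mathbb{R}^S$ is feasible if for every $j\in[k]$, $F^*$ is a minimum-cost member of $\mathcal{F}$ with respect to $c^j-p$, i.e. $(c^j-p)(F^* )\le(c^j-p)(F)$ for all $F\in\mathcal{F}$. The problem is feasible if a feasible deviation vector exists. The objective is $\|p\|_{\infty,w}=\max\{w(s)\cdot|p(s)|\mid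 s\in S\}$. *)

(* Defs.v *)
From mathcomp Require Import all_boot all_order all_algebra.
From mathcomp Require Import classical_sets reals constructive_ereal.

Set Implicit Arguments.
Unset Strict Implicit.
Unset Printing Implicit Defensive.

Import Order.TTheory GRing.Theory Num.Theory.

Local Open Scope ring_scope.

Section InverseOptimization.
Variables (R : realType) (S : finType).
Implicit Types (x c p w : {ffun S -> R}) (X Y : {set S}).

Definition vsum x X : R := \sum_(s in X) x s.

Definition vinv w : {ffun S -> R} := [ffun s => (w s)^-1].

Definition symdiff X Y : {set S} := (X :\: Y) :|: (Y :\: X).

(* For w > 0 all the terms are nonnegative, so the neutral element 0 does not
   affect the maximum, which is over a nonempty set whenever S is nonempty. *)
Definition winf_norm w p : R := \big[Num.max/0]_(s : S) (w s * `|p s|).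

Definition min_cost (Fs : {set {set S}}) c X : Prop :=
  X \in Fs /\ forall F, F \in Fs -> vsum c X <= vsum c F.

Definition feasible_deviation (Fs : {set {set S}}) (Fstar : {set S}) (k : nat)
    (c : 'I_k -> {ffun S -> R}) p : Prop :=
  forall j : 'I_k, min_cost Fs (c j - p) Fstar.

End InverseOptimization.

Definition is_min {d : Order.disp_t} {T : porderType d} (A : set T) (m : T) :
  Prop := A m /\ lbound A m.

(* Main.v *)
Require Import Defs.
From mathcomp Require Import all_boot all_order all_algebra.
From mathcomp Require Import classical_sets reals constructive_ereal.

(** Write [X] for the given solution.  Feasibility of [p] says that, for each
    cost function [c] and each solution [F], the gap [c(X) - c(F)] is at most
    [p(X) - p(F)] ([vsum_sub_le_sub]).  Elements common to [X] and [F] cancel, so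
    [p(X) - p(F)] is the sum of [p(s)] over [X \ F] minus the sum over [F \ X]
    ([vsum_sub_symdiff]).

    Lower bound: [|p(s)| <= N / w(s)], where [N] is the weighted norm of [p], so
    that signed sum is at most [N] times the sum of [1 / w] over the symmetric
    difference of [X] and [F] ([vsum_sub_le]); hence every ratio is at most [N].

    Attainment: the sign of [s] in the signed sum depends on [X] alone, not on
    [F], so a single vector makes the estimate an equality for all [F] at once,
    namely [d / w] on [X] and [- d / w] off [X] ([extremal_deviation_sub]).  For
    [d >= 0] its norm is [d], and it is feasible as soon as [d] is at least every
    ratio; the least such [d] is the right-hand side. *)

Set Implicit Arguments.
Unset Strict Implicit.

Import Order.TTheory GRing.Theory Num.Theory.
Local Open Scope classical_set_scope.
Local Open Scope ring_scope.

(** * Signed sums over a symmetric difference *)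

Lemma vsumB (R : realType) (S : finType) (x y : {ffun S -> R}) (X : {set S}) :
  vsum (x - y) X = vsum x X - vsum y X.
Proof. by rewrite /vsum -sumrB; apply: eq_bigr => s _; rewrite !ffunE. Qed.

Lemma vsum_sub_symdiff (R : realType) (S : finType) (x : {ffun S -> R})
    (X Y : {set S}) :
  vsum x X - vsum x Y =
    \sum_(s in symdiff X Y) (if s \in X then x s else - x s).
Proof.
rewrite /vsum (big_mkcond (mem X)) (big_mkcond (mem Y)) -sumrB [RHS]big_mkcond.
apply: eq_bigr => s _ /=; rewrite !inE.
by case: (s \in X); case: (s \in Y); rewrite /= ?subrr ?subr0 ?sub0r.
Qed.

Lemma vsum_vinv_gt0 (R : realType) (S : finType) (w : {ffun S -> R})
    (hw : forall s, 0 < w s) (X Y : {set S}) :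
  X != Y -> 0 < vsum (vinv w) (symdiff X Y).
Proof.
move=> neXY; have w1 s : 0 < vinv w s by rewrite ffunE invr_gt0.
have [s sXY] : exists s, s \in symdiff X Y.
  apply/set0Pn; apply: contraNneq neXY => XY0.
  apply/eqP/setP => s; move/setP/(_ s): XY0; rewrite !inE.
  by case: (s \in X); case: (s \in Y).
rewrite /vsum (bigD1 s) //= ltr_pwDl //.
by apply: sumr_ge0 => t _; apply: ltW.
Qed.

(** * The weighted norm *)

Lemma winf_norm_ge0 (R : realType) (S : finType) (w p : {ffun S -> R}) :
  0 <= winf_norm w p.
Proof. exact: bigmax_ge_id. Qed.

Lemma normr_le_winf_norm (R : realType) (S : finType) (w p : {ffun S -> R})
    (hw : forall s, 0 < w s) (s : S) :
  `|p s| <= winf_norm w p * vinv w s.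
Proof. by rewrite ffunE ler_pdivlMr // mulrC; apply: le_bigmax. Qed.

(** Duality of weighted norms: a signed sum of [p] is bounded by the weighted
    sup norm of [p] times the dual norm of the signs. *)
Lemma vsum_sub_le (R : realType) (S : finType) (w p : {ffun S -> R})
    (hw : forall s, 0 < w s) (X Y : {set S}) :
  vsum p X - vsum p Y <= winf_norm w p * vsum (vinv w) (symdiff X Y).
Proof.
rewrite vsum_sub_symdiff /vsum mulr_sumr; apply: ler_sum => s _.
apply: le_trans (normr_le_winf_norm p hw s).
by case: ifP => _; [exact: ler_norm | rewrite -normrN ler_norm].
Qed.

(** * The extremal deviation vector *)

Definition extremal_deviation (R : realType) (S : finType) (w : {ffun S -> R})
    (X : {set S}) (d : R) : {ffun S -> R} :=
  [ffun s => if s \in X then d * vinv w s else - (d * vinv w s)].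

(** The signs in [extremal_deviation w X d] cancel those of the signed sum over
    the symmetric difference, whatever [Y] is.  For [d >= 0] this is the equality
    case of [vsum_sub_le], for all [Y] simultaneously. *)
Lemma extremal_deviation_sub (R : realType) (S : finType) (w : {ffun S -> R})
    (X Y : {set S}) (d : R) :
  vsum (extremal_deviation w X d) X - vsum (extremal_deviation w X d) Y =
    d * vsum (vinv w) (symdiff X Y).
Proof.
rewrite vsum_sub_symdiff /vsum mulr_sumr; apply: eq_bigr => s _.
by rewrite [extremal_deviation _ _ _ _]ffunE; case: (s \in X); rewrite ?opprK.
Qed.

Lemma winf_norm_extremal_deviation (R : realType) (S : finType)
    (hS : (0 < #|S|)%N) (w : {ffun S -> R}) (hw : forall s, 0 < w s)
    (X : {set S}) (d : R) (d0 : 0 <= d) :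
  winf_norm w (extremal_deviation w X d) = d.
Proof.
have term s : w s * `|extremal_deviation w X d s| = d.
  have -> : `|extremal_deviation w X d s| = `|d * vinv w s|.
    by rewrite [extremal_deviation _ _ _ _]ffunE; case: ifP; rewrite ?normrN.
  rewrite ffunE ger0_norm; last by rewrite divr_ge0 // ltW.
  by rewrite mulrC divfK // gt_eqF.
rewrite /winf_norm (eq_bigr _ (fun s _ => term s)).
have [s _] := card_gt0P hS.
apply/le_anti/andP; split; first exact: bigmax_le.
exact: (le_bigmax _ (fun=> d) s).
Qed.

(** * Feasibility in terms of cost gaps *)

Lemma vsum_sub_le_sub (R : realType) (S : finType) (c p : {ffun S -> R})
    (X Y : {set S}) :
  (vsum (c - p) X <= vsum (c - p) Y) =
    (vsum c X - vsum c Y <= vsum p X - vsum p Y).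
Proof.
rewrite !vsumB lerBlDr [RHS]lerBlDr; congr (_ <= _).
by rewrite addrAC -addrA addrC.
Qed.

Lemma cost_gap_le_winf_norm (R : realType) (S : finType) (Fs : {set {set S}})
    (Fstar : {set S}) (k : nat) (c : 'I_k -> {ffun S -> R})
    (w p : {ffun S -> R}) (hw : forall s, 0 < w s) :
  feasible_deviation Fs Fstar c p -> forall (j : 'I_k) (F : {set S}), F \in Fs ->
  vsum (c j) Fstar - vsum (c j) F
    <= winf_norm w p * vsum (vinv w) (symdiff Fstar F).
Proof.
move=> feas_p j F FFs; have [_ /(_ F FFs)] := feas_p j.
by rewrite vsum_sub_le_sub => /le_trans; apply; apply: vsum_sub_le.
Qed.

Lemma extremal_deviation_feasible (R : realType) (S : finType)
    (Fs : {set {set S}}) (Fstar : {set S}) (hFstar : Fstar \in Fs) (k : nat)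
    (c : 'I_k -> {ffun S -> R}) (w : {ffun S -> R}) (d : R) :
  (forall (j : 'I_k) (F : {set S}), F \in Fs -> F != Fstar ->
    vsum (c j) Fstar - vsum (c j) F
      <= d * vsum (vinv w) (symdiff Fstar F)) ->
  feasible_deviation Fs Fstar c (extremal_deviation w Fstar d).
Proof.
move=> gap_le j; split=> // F FFs.
have [->//|neF] := eqVneq F Fstar.
by rewrite vsum_sub_le_sub extremal_deviation_sub; apply: gap_le.
Qed.

Unset Implicit Arguments.
Set Strict Implicit.

(* The maxima on the right-hand side are taken in the extended reals, with
   value -oo over an empty index set. *)
Theorem theorem14 (R : realType) (S : finType) (hS : (0 < #|S|)%N)
    (Fs : {set {set S}}) (Fstar : {set S}) (hFstar : Fstar \in Fs)
    (k : nat) (hk : (0 < k)%N) (c : 'I_k -> {ffun S -> R})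
    (w : {ffun S -> R}) (hw : forall s : S, 0 < w s)
    (hfeas : exists p : {ffun S -> R}, feasible_deviation Fs Fstar c p) :
  is_min [set (winf_norm w p)%:E | p in [set p | feasible_deviation Fs Fstar c p]]
    (maxe 0%:E
      (\big[maxe/-oo%E]_(j < k) \big[maxe/-oo%E]_(F in Fs | F != Fstar)
        ((vsum (c j) Fstar - vsum (c j) F)
           / vsum (vinv w) (symdiff Fstar F))%:E)).
Proof.
set B := (\big[maxe/-oo%E]_(j < k) _)%E; split; last first.
  move=> _ [p feas_p <-]; rewrite ge_max lee_fin winf_norm_ge0 /=.
  apply: bigmax_le => [|j _]; first exact: leNye.
  apply: bigmax_le => [|F /andP[FFs neF]]; first exact: leNye.
  rewrite lee_fin ler_pdivrMr; last by rewrite vsum_vinv_gt0 // eq_sym.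
  exact: cost_gap_le_winf_norm.
(* Every ratio is a real, so the maximum is not +oo, and the comparison with 0
   excludes -oo, the value over an empty index set. *)
have [d Bd] : exists d : R, maxe 0%:E B = d%:E.
  have B_fin : (B < +oo)%E.
    apply: bigmax_lt => [//|j _].
    by apply: bigmax_lt => [|F _] //; exact: ltry.
  have : (maxe 0%:E B < +oo)%E by rewrite gt_max ltry.
  have : (0%:E <= maxe 0%:E B)%E by rewrite le_max lexx.
  by case: (maxe _ _) => // d; exists d.
have d_ge0 : 0 <= d by rewrite -lee_fin -Bd le_max lexx.
rewrite Bd; exists (extremal_deviation w Fstar d); last first.
  by rewrite winf_norm_extremal_deviation.
apply: extremal_deviation_feasible => // j F FFs neF.
rewrite -ler_pdivrMr; last by rewrite vsum_vinv_gt0 // eq_sym.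
rewrite -lee_fin -Bd le_max; apply/orP; right.
apply: (bigmax_sup j) => //.
by apply: (bigmax_sup F) => //; rewrite FFs.
Qed.
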